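(* The quantum cluster algebra $\mathcal A_t(\tilde{\boldsymbol u},\tilde B,\tilde L)$ is isomorphic to the quantum cluster algebra $\mathcal A_t(\Gamma^-,\Lambda)$.
   Context: **Cartan data.** $\mathfrak g$ is a simple complex Lie algebra of type $A$, $D$ or $E$, $I=\{1,\dots,n\}$ is the vertex set of its Dynkin diagram, $i\sim j$ means that $i,j$ are adjacent. Cartan matrix: $C_{ii}=2$, $C_{ij}=-1$ if $i\sim j$, $C_{ij}=0$ otherwise. The quantum Cartan matrix $C(z)$ has $C_{ii}(z)=z+z^{-1}$ and $C_{ij}(z)=C_{ij}$ for $i\neq j$; its inverse $\widetilde C(z)$ has entries expanded as $\widetilde C_{ij}(z)=\sum_{m\ge 1}\widetilde C_{ij}(m)z^m\in\mathbb Z[[z]]$, and $\widetilde C_{ij}(m)=0$ for $m\le 0$. Put $\mathbf C_{ij}(m)=\widetilde C_{ij}(m)+\widetilde C_{ij}(-m)$ and $\mathcal N_{ij}(m)=\mathbf C_{ij}(m+1)-\mathbf C_{ij}(m-1)$ for $m\in\mathbb Z$. $\mathcal F_{ij}:\mathbb Z\to\mathbb Z$ is the odd function with $\mathcal F_{ij}(m)=-\sum_{k\ge1,\ m\ge 2k-1}\widetilde C_{ij}(m-2k+1)$ for $m\ge0$. Fix a height function $\xi:I\to\{0,1\}$ with $\xi_i\ne\xi_j$ whenever $i\sim j$. Let $\hat I=\{(i,r)\in I\times\mathbb Z: r\in 2\mathbb Z+\xi_i\}$, $\hat I^-=\{(i,r)\in\hat I: r\le 0\}$, $\hat I^-_{\le2}=\{(i,r)\in\hat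 I:r\le2\}$. **Quivers.** $\Gamma$ is the quiver with vertex set $\hat I$ and an arrow $(i,r)\to(j,s)$ iff $C_{ij}\ne0$ and $s=r+C_{ij}$. $\Gamma^-$ is its subquiver with vertex set $\hat I^-_{\le2}$, in which the vertices $(i,r)$ with $r>0$ (i.e. $(i,2-\xi_i)$, $i\in I$) are frozen; arrows between frozen vertices are disregarded. **Quantum cluster algebras.** A quantum seed consists of $t$-commuting variables indexed by the vertices of a quiver (frozen and mutable), in a quantum torus over $\mathbb Z[t^{\pm1/2}]$ whose $t$-commutation relations $x_v*x_w=t^{\Lambda_{vw}}x_w*x_v$ are encoded by a skew-symmetric matrix $\Lambda$ compatible with the quiver (Berenstein–Zelevinsky, with a constant-sign diagonal compatibility condition); mutation at a mutable vertex $v$ replaces $x_v$ by the sum of the bar-invariant Laurent monomials $x_v^{-1}\prod_{w\to v}x_w$ and $x_v^{-1}\prod_{v\to w}x_w$. The quantum cluster algebra is the $\mathbb Z[t^{\pm1/2}]$-algebra generated by all quantum cluster variables and frozen variables (with the same convention for inverting frozen variables in both algebras). **$\mathcal A_t(\Gamma^-,\Lambda)$** has quiver $\Gamma^-$ and initial variables $z_{i,r}$, $(i,r)\in\hat I^-_{\le2}$, with $z_{i,r}*z_{j,s}=t^{\Lambda_{(i,r),(j,s)}}z_{j,s}*z_{i,r}$, $\Lambda_{(i,r),(j,s)}=\mathcal F_{ij}(s-r)$. **$\mathcal A_t(\tilde{\boldsymbol u},\tilde B,\tilde L)$** has quiver $\Gamma^-$ ($\tilde B$ is its adjacency matrix)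 and initial variables $\tilde{\boldsymbol u}=\{\tilde u_{i,r}\}_{(i,r)\in\hat I^-_{\le2}}$, where $\tilde u_{i,r}=u_{i,r}f_i$ (commutative, i.e. bar-invariant, monomial) if $r\le0$ and $\tilde u_{i,r}=f_i$ otherwise. Here $u_{i,r}$ ($(i,r)\in\hat I^-$) and $f_i$ ($i\in I$) generate a quantum torus with relations: $u_{i,r}*u_{j,s}=t^{L((i,r),(j,s))}u_{j,s}*u_{i,r}$ with $L((i,r),(j,s))=\sum_{k\ge0,\,r+2k\le0}\ \sum_{l\ge0,\,s+2l\le0}\mathcal N_{ij}(s+2l-r-2k)$; $f_j*u_{i,r}=t^{\underline t_j(i,r)}u_{i,r}*f_j$ with $\underline t_j(i,r)=-\mathcal F_{ji}(2-r-\xi_j)$; and the $f_j$ pairwise commute. $\tilde L$ is the matrix encoding the resulting $t$-commutation relations of the $\tilde u_{i,r}$. *)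

(* Defs.v *)
From HB Require Import structures.
From mathcomp Require Import all_boot all_order all_algebra.
From mathcomp Require Import finmap.
From mathcomp Require Import monalg.
From mathcomp Require Import boolp.
From mathcomp Require Import zify.

Set Implicit Arguments.
Unset Strict Implicit.
Unset Printing Implicit Defensive.

Import Order.TTheory GRing.Theory Num.Theory.
Local Open Scope ring_scope.

Section QuantumTori.

(* V indexes the t-commuting variables.  {malg int[V]} is the free abelian group
   Z^(V) of finitely supported exponent vectors, with basis << v >> and
   coordinates a@_v.  V is allowed to be infinite. *)
Variable V : choiceType.
Implicit Types (L : V -> V -> int) (a b : {malg int[V]}).

Definition bilin L a b : int :=
  \sum_(v <- msupp a) \sum_(w <- msupp b) a@_v * b@_w * L v w.

Fixpoint ordered_form L a (s : seq V) : int :=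
  if s is v :: s' then \sum_(w <- s') a@_v * a@_w * L v w + ordered_form L a s'
  else 0.

(* With x_v x_w = t^(L v w) x_w x_v and h standing for t^(1/2), this is the
   bar-invariant monomial
     t^(- 1/2 \sum_(p < q) a_(v_p) a_(v_q) L(v_p, v_q)) x_(v_1)^a_(v_1) ... x_(v_k)^a_(v_k);
   it does not depend on the order in which the support v_1, ..., v_k of a is
   listed. *)
Definition qmonomial (F : unitRingType) L (h : F) (x : V -> F) a : F :=
  h ^ (- ordered_form L a (msupp a)) * \prod_(v <- msupp a) x v ^ a@_v.

(* The pair (k, a) stands for t^(k/2) times the bar-invariant monomial of
   exponent a; these form a Z-basis of the quantum torus over Z[t^(1/2), t^(-1/2)]. *)
Definition qtorus_eval (F : unitRingType) L (h : F) (x : V -> F)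
    (P : {malg int[(int * {malg int[V]})%type]}) : F :=
  \sum_(p <- msupp P) (h ^ p.1 * qmonomial L h x p.2) *~ P@_p.

(* F is a skew field of fractions of the quantum torus over Z[t^(1/2), t^(-1/2)]
   with generators x_v and t-commutation matrix L (an Ore domain when L is
   skew-symmetric, so such an F exists and is unique up to unique isomorphism). *)
Record qtorus_fraction_field (F : unitRingType) L (h : F) (x : V -> F) : Prop :=
  QTorusFractionField {
    qff_division : forall u : F, u != 0 -> u \is a GRing.unit;
    qff_central : forall u : F, h * u = u * h;
    qff_h_neq0 : h != 0;
    qff_x_neq0 : forall v, x v != 0;
    qff_comm : forall v w, x v * x w = h ^ (2 * L v w) * (x w * x v);
    qff_free : forall P, qtorus_eval L h x P = 0 -> P = 0;
    qff_fraction : forall u : F, exists P Q,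
      Q != 0 /\ u = qtorus_eval L h x P * (qtorus_eval L h x Q)^-1 }.

End QuantumTori.

Section QuantumClusterAlgebras.

Variable V : choiceType.

(* exch v is the column of the exchange matrix at v: (exch v)@_w is the number of
   arrows w -> v minus the number of arrows v -> w.  Only columns at mutable
   vertices matter. *)
Record seed (F : Type) := Seed {
  cvar : V -> F;
  exch : V -> {malg int[V]};
  qform : V -> V -> int }.

Definition pos_part (a : {malg int[V]}) : {malg int[V]} :=
  \sum_(v <- msupp a) << Num.max (a@_v) 0 *g v >>.

Definition compatible (mu : {pred V}) (B : V -> {malg int[V]})
    (L : V -> V -> int) : Prop :=
  (forall v w, L w v = - L v w) /\
  exists d : V -> int,
    ((forall v, v \in mu -> 0 < d v) \/ (forall v, v \in mu -> d v < 0)) /\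
    (forall v w, v \in mu -> bilin L (B v) << w >> = if v == w then d v else 0).

Variables (F : unitRingType) (h : F).

Definition is_quantum_seed (mu : {pred V}) (S : seed F) : Prop :=
  qtorus_fraction_field (qform S) h (cvar S) /\
  compatible mu (exch S) (qform S).

(* Exponents of x_v^-1 \prod_(w -> v) x_w and x_v^-1 \prod_(v -> w) x_w. *)
Definition in_exponent (B : V -> {malg int[V]}) (v : V) : {malg int[V]} :=
  pos_part (B v) - << v >>.
Definition out_exponent (B : V -> {malg int[V]}) (v : V) : {malg int[V]} :=
  pos_part (- B v) - << v >>.

Definition mutate_var (S : seed F) (v : V) : V -> F := fun w =>
  if w == v then
    qmonomial (qform S) h (cvar S) (in_exponent (exch S) v)
    + qmonomial (qform S) h (cvar S) (out_exponent (exch S) v)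
  else cvar S w.

(* b'_(wu) = - b_(wu) if v is w or u, and otherwise
   b'_(wu) = b_(wu) + [b_(wv)]_+ [b_(vu)]_+ - [- b_(wv)]_+ [- b_(vu)]_+. *)
Definition mutate_exch (B : V -> {malg int[V]}) (v : V) : V -> {malg int[V]} :=
  fun u => if u == v then - B v else
    B u - << 2 * (B u)@_v *g v >>
    + Num.max ((B u)@_v) 0 *: pos_part (B v)
    - Num.max (- (B u)@_v) 0 *: pos_part (- B v).

(* The new variable at v t-commutes with the others like either of the two
   monomials of the exchange relation (they agree there, by compatibility). *)
Definition mutate_form (B : V -> {malg int[V]}) (L : V -> V -> int) (v : V) :
    V -> V -> int :=
  let e w := if w == v then in_exponent B v else << w >> in
  fun p q => bilin L (e p) (e q).

Definition mutate (S : seed F) (v : V) : seed F :=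
  Seed (mutate_var S v) (mutate_exch (exch S) v)
       (mutate_form (exch S) (qform S) v).

Variables (mu : {pred V}) (S : seed F) (invf : bool).

(* The subring generated by t^(1/2), t^(-1/2), all cluster variables and the frozen
   variables, together with the inverses of the frozen variables when invf. *)
Inductive in_qcluster : F -> Prop :=
| in_qcluster_h : in_qcluster h
| in_qcluster_hV : in_qcluster h^-1
| in_qcluster_var (s : seq V) (v : V) of all [in mu] s :
    in_qcluster (cvar (foldl mutate S s) v)
| in_qcluster_frozenV (v : V) of invf & v \notin mu :
    in_qcluster (cvar S v)^-1
| in_qcluster1 : in_qcluster 1
| in_qclusterB a b of in_qcluster a & in_qcluster b : in_qcluster (a - b)
| in_qclusterM a b of in_qcluster a & in_qcluster b : in_qcluster (a * b).

Definition qcluster_pred : {pred F} := fun a => `[< in_qcluster a >].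

Fact qcluster_subring : subring_closed qcluster_pred.
Proof.
split; first exact/asboolP/in_qcluster1.
- by move=> a b /asboolP ha /asboolP hb; apply/asboolP/in_qclusterB.
- by move=> a b /asboolP ha /asboolP hb; apply/asboolP/in_qclusterM.
Qed.

HB.instance Definition _ :=
  GRing.isSubringClosed.Build F qcluster_pred qcluster_subring.

Record qcluster_algebra := QCluster {
  qcluster_val : F;
  _ : qcluster_val \in qcluster_pred }.

HB.instance Definition _ := [isSub for qcluster_val].
HB.instance Definition _ := [Choice of qcluster_algebra by <:].
HB.instance Definition _ := [SubChoice_isSubNzRing of qcluster_algebra by <:].

Fact qcluster_h_subproof : h \in qcluster_pred.
Proof. exact/asboolP/in_qcluster_h. Qed.

Definition qcluster_h : qcluster_algebra := QCluster qcluster_h_subproof.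

End QuantumClusterAlgebras.

(* Isomorphism of Z[t^(1/2), t^(-1/2)]-algebras: a ring isomorphism preserving t^(1/2). *)
Definition qcluster_iso (V1 V2 : choiceType) (F1 F2 : unitRingType)
    (h1 : F1) (mu1 : {pred V1}) (S1 : seed V1 F1)
    (h2 : F2) (mu2 : {pred V2}) (S2 : seed V2 F2) (invf : bool) : Prop :=
  exists phi : {rmorphism qcluster_algebra h1 mu1 S1 invf ->
                          qcluster_algebra h2 mu2 S2 invf},
    bijective phi /\
    phi (qcluster_h h1 mu1 S1 invf) = qcluster_h h2 mu2 S2 invf.

Inductive dynkin := TypeA of nat | TypeD of nat | TypeE of nat.

Definition is_dynkin (X : dynkin) : bool :=
  match X with
  | TypeA n => (1 <= n)%N
  | TypeD n => (4 <= n)%N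
  | TypeE n => (6 <= n <= 8)%N
  end.

Definition rank (X : dynkin) : nat :=
  match X with TypeA n | TypeD n | TypeE n => n end.

(* Bourbaki's labelling, shifted to start from 0. *)
Definition edges (X : dynkin) : seq (nat * nat) :=
  match X with
  | TypeA n => [seq (k, k.+1) | k <- iota 0 n.-1]
  | TypeD n => (n - 3, n - 1)%N :: [seq (k, k.+1) | k <- iota 0 n.-2]
  | TypeE n => [:: (0, 2); (1, 3)]%N ++ [seq (k, k.+1) | k <- iota 2 (n - 3)]
  end.

Section CartanData.

Variable X : dynkin.
Local Notation I := 'I_(rank X).

Definition adj : rel I := fun i j =>
  ((i : nat, j : nat) \in edges X) || ((j : nat, i : nat) \in edges X).

Definition cartan : 'M[int]_(rank X) :=
  \matrix_(i, j) (if i == j then 2 else if adj i j then -1 else 0).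

(* Coefficient of z^m in the quantum Cartan matrix. *)
Definition qcartan (m : int) : 'M[int]_(rank X) :=
  \matrix_(i, j) (if i == j then ((m == 1) || (m == -1))%:R
                  else if m == 0 then cartan i j else 0).

(* Ct m is the coefficient of z^m in the inverse of the quantum Cartan matrix,
   expanded at z = 0; qcartan a vanishes for a outside {-1, 0, 1}. *)
Definition qcartan_inverse (Ct : int -> 'M[int]_(rank X)) : Prop :=
  [/\ forall m, m <= 0 -> Ct m = 0,
      forall m, \sum_(a <- [:: -1; 0; 1]) qcartan a *m Ct (m - a) = (m == 0)%:R%:M
    & forall m, \sum_(a <- [:: -1; 0; 1]) Ct (m - a) *m qcartan a = (m == 0)%:R%:M].

(* Auxiliary recursion, used only to show that the inverse exists. *)
Fixpoint qcartan_inv_rec (m : nat) : 'M[int]_(rank X) * 'M[int]_(rank X) :=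
  if m is m'.+1 then
    let: (a, b) := qcartan_inv_rec m' in (b, (2%:M - cartan) *m b - a)
  else (0, 1%:M).

Fact qcartan_inverse_exists : exists Ct, qcartan_inverse Ct.
Proof.
pose U m := (qcartan_inv_rec m).1.
have [A AE] : exists A : 'M[int]_(rank X), A = 2%:M - cartan by exists (2%:M - cartan).
have U0 : U 0%N = 0 by [].
have U1 : U 1%N = 1%:M by [].
have US m : U m.+2 = A *m U m.+1 - U m by rewrite AE /U /=; case: qcartan_inv_rec.
have UC m : U m *m A = A *m U m.
  elim/ltn_ind: m => -[|[|m]] IH; rewrite ?U0 ?U1 ?mulmx0 ?mul0mx ?mulmx1 ?mul1mx //.
  by rewrite US mulmxBl mulmxBr -mulmxA !IH ?ltnS ?leqnSn.
have q0 : qcartan 0 = - A.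
  rewrite AE; apply/matrixP => i j; rewrite !mxE eqxx /=.
  by case: eqVneq => _; rewrite ?mulr1n ?mulr0n ?subrr ?oppr0 ?sub0r ?opprK.
have q1 : qcartan 1 = 1%:M.
  by apply/matrixP => i j; rewrite !mxE /=; case: eqVneq.
have qN1 : qcartan (-1) = 1%:M.
  by apply/matrixP => i j; rewrite !mxE /=; case: eqVneq.
pose Ct (m : int) := if m is Posz k then U k else 0.
have CtE m : Ct (m + 1) + Ct (m - 1) - A *m Ct m = (m == 0)%:R%:M.
  case: m => [[|m]|[|m]].
  - by rewrite /Ct /= U0 U1 mulmx0 subr0 addr0.
  - have -> : m.+1%:Z + 1 = m.+2%:Z by lia.
    have -> : m.+1%:Z - 1 = m%:Z by lia.
    by rewrite /Ct US subrK subrr raddf0.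
  - by rewrite /Ct /= U0 mulmx0 subr0 addr0 raddf0.
  - have -> : Negz m.+1 + 1 = Negz m by lia.
    have -> : Negz m.+1 - 1 = Negz m.+2 by lia.
    by rewrite /Ct mulmx0 subr0 addr0 raddf0.
have CtC m : Ct m *m A = A *m Ct m by case: m => k; rewrite /Ct ?mulmx0 ?mul0mx.
exists Ct; split => [[[|k]|k] //|m|m];
  rewrite !big_cons big_nil subr0 opprK q0 q1 qN1 ?mul1mx ?mulmx1 ?mulNmx ?mulmxN
          ?CtC [X in _ + (_ + X)]addr0 -(CtE m) addrA [RHS]addrAC //.
Qed.

Variable Ct : int -> 'M[int]_(rank X).

Definition bfC (i j : I) (m : int) : int := Ct m i j + Ct (- m) i j.

Definition calN (i j : I) (m : int) : int := bfC i j (m + 1) - bfC i j (m - 1).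

Definition calF_nat (i j : I) (m : nat) : int :=
  - \sum_(1 <= k < m.+2 | (2 * k - 1 <= m)%N) Ct (m%:Z - 2 * k%:Z + 1) i j.

Definition calF (i j : I) (m : int) : int :=
  if 0 <= m then calF_nat i j `|m|%N else - calF_nat i j `|m|%N.

Variable xi : I -> bool.

Definition xiZ (i : I) : int := (xi i : nat)%:Z.

Definition in_hatI (p : I * int) : bool := (2 %| p.2 - xiZ p.1)%Z.

Definition hatI_neg := {p : I * int | in_hatI p && (p.2 <= 0)}.
Definition hatI_le2 := {p : I * int | in_hatI p && (p.2 <= 2)}.

HB.instance Definition _ := Choice.on hatI_neg.
HB.instance Definition _ := Choice.on hatI_le2.

Definition mutable : {pred hatI_le2} := fun v => (val v).2 <= 0.

Definition Gamma_arrow : rel (I * int) := fun p q =>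
  (cartan p.1 q.1 != 0) && (q.2 == p.2 + cartan p.1 q.1).

Definition Gamma_neg_arrow : rel hatI_le2 := fun v w =>
  Gamma_arrow (val v) (val w) && ~~ ((v \notin mutable) && (w \notin mutable)).

(* A finite set of vertices containing all the neighbours of v in Gamma. *)
Definition nbhd (v : hatI_le2) : {fset hatI_le2} :=
  [fset w in pmap insub
     [seq (j, (val v).2 + s : int) | j : I <- enum I, s <- ([:: -2; -1; 1; 2] : seq int)]]%fset.

(* The column at v of the signed adjacency matrix of Gamma^-. *)
Definition exch_Gamma (v : hatI_le2) : {malg int[hatI_le2]} :=
  [malg w in nbhd v => (Gamma_neg_arrow w v)%:R - (Gamma_neg_arrow v w)%:R].

Fact exch_GammaE (v w : hatI_le2) :
  (exch_Gamma v)@_w = (Gamma_neg_arrow w v)%:R - (Gamma_neg_arrow v w)%:R.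
Proof.
rewrite mcoeffE; case: ifP => // /negbT nb.
suff [-> ->] : Gamma_neg_arrow w v = false /\ Gamma_neg_arrow v w = false by [].
have nbP s : s \in ([:: -2; -1; 1; 2] : seq int) ->
    (val w).2 != (val v).2 + s.
  move=> ins; apply/negP => /eqP e; case/negP: nb.
  rewrite !inE mem_pmap; apply/mapP; exists (val w); last by rewrite valK.
  rewrite [val w]surjective_pairing e; apply: allpairs_f => //.
  by rewrite mem_enum.
split; apply/negP => /andP[/andP[+ /eqP e] _]; rewrite mxE.
  rewrite mxE in e; case: ifP e => [_ e _|_].
    by have := nbP (-2) isT; rewrite e addrK eqxx.
  case: ifP => [_ e _|//].
  by have := nbP 1 isT; rewrite e subrK eqxx.
rewrite mxE in e; case: ifP e => [_ e _|_].
  by have := nbP 2 isT; rewrite e eqxx.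
case: ifP => [_ e _|//].
by have := nbP (-1) isT; rewrite e eqxx.
Qed.

Definition Lambda (v w : hatI_le2) : int :=
  calF (val v).1 (val w).1 ((val w).2 - (val v).2).

Definition seed_Gamma (F : Type) (z : hatI_le2 -> F) : seed hatI_le2 F :=
  Seed z exch_Gamma Lambda.

(* The bounds on k and l are implied by the filters, as r, s <= 0. *)
Definition calL (v w : hatI_neg) : int :=
  let: (i, r) := val v in let: (j, s) := val w in
  \sum_(0 <= k < `|r|.+1 | r + 2 * k%:Z <= 0)
    \sum_(0 <= l < `|s|.+1 | s + 2 * l%:Z <= 0)
      calN i j (s + 2 * l%:Z - r - 2 * k%:Z).

Definition t_under (j : I) (v : hatI_neg) : int :=
  - calF j (val v).1 (2 - (val v).2 - xiZ j).

(* inl (i, r) indexes u_(i, r) and inr j indexes f_j. *)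
Definition uf_gen := (hatI_neg + I)%type.
HB.instance Definition _ := Choice.on uf_gen.

Definition uf_form (p q : uf_gen) : int :=
  match p, q with
  | inl v, inl w => calL v w
  | inr j, inl v => t_under j v
  | inl v, inr j => - t_under j v
  | inr _, inr _ => 0
  end.

Definition tilde_exponent (v : hatI_le2) : {malg int[uf_gen]} :=
  let f : uf_gen := inr (val v).1 in
  if insub (val v) is Some v' then << (inl v' : uf_gen) >> + << f >> else << f >>.

Definition tilde_u (F : unitRingType) (h : F) (y : uf_gen -> F) (v : hatI_le2) : F :=
  qmonomial uf_form h y (tilde_exponent v).

Definition tilde_L (v w : hatI_le2) : int :=
  bilin uf_form (tilde_exponent v) (tilde_exponent w).

Definition seed_tilde (F : unitRingType) (h : F) (y : uf_gen -> F) :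
    seed hatI_le2 F :=
  Seed (tilde_u h y) exch_Gamma tilde_L.

End CartanData.

(* Main.v *)
(* The two initial seeds have the same exchange matrix, so it suffices to compare
   the t-commutation matrices and the ambient skew fields.

   1. F_ij(m + 2) - F_ij(m) = - C_ij(m + 1), with boldface C, hence N_ij is minus
      the second difference (of step 2) of F_ij.  The double sum defining L
      telescopes in both directions and gives
        L((i,r),(j,s)) = F_ij(s - r) + F_ij(2 - xi_i - s) - F_ij(2 - xi_j - r).
      Multiplying u_(i,r) by f_i cancels the two boundary terms: \tilde L = Lambda.
   2. The exponents of the \tilde u_(i,r) form a basis of the lattice Z^(u, f), so
      they generate the same quantum torus and the same skew field of fractions.
   3. Two skew fields of fractions of the same quantum torus are isomorphic; the Ore
      condition needed to transport P Q^-1 is read off from the assumption that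
      every element is such a fraction.  The isomorphism commutes with mutations.
   4. Compatibility with Lambda is the identity C(z) \tilde C(z) = 1: by 1, column
      (i,r) of the exchange matrix pairs with (k,s) to minus the coefficient of
      z^(s - r) in the entry (i,k) of C(z) (\tilde C(z) + \tilde C(z^-1)) = 2. *)

Require Import Defs.
From HB Require Import structures.
From mathcomp Require Import all_boot all_order all_algebra.
From mathcomp Require Import finmap monalg boolp zify ring.

Set Implicit Arguments.
Unset Strict Implicit.
Unset Printing Implicit Defensive.

Import Order.TTheory GRing.Theory Num.Theory.
Local Open Scope ring_scope.

(** * Additive extensions and bilinear forms *)

Section LinearExtension.

Variables (K : choiceType) (U : zmodType) (e : K -> U).
Implicit Types a b : {malg int[K]}.

(** The universal property of the free abelian group. [qtorus_eval] is convertible to such an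
    extension and [bilin] is an iterated one, so additivity is proved once for both. *)
Definition linext a : U := \sum_(k <- msupp a) e k *~ a@_k.

Lemma linextEw (s : {fset K}) a :
  (msupp a `<=` s)%fset -> linext a = \sum_(k <- s) e k *~ a@_k.
Proof.
move=> sub; apply: big_fset_incl => // k _ /mcoeff_outdom ->.
by rewrite mulr0z.
Qed.

Fact linext_is_zmod_morphism : zmod_morphism linext.
Proof.
move=> a b; pose s := (msupp a `|` msupp b)%fset.
rewrite (@linextEw s a) ?fsubsetUl // (@linextEw s b) ?fsubsetUr //.
rewrite (@linextEw s (a - b)) ?msuppB_le // -sumrB.
by apply: eq_bigr => k _; rewrite mcoeffB mulrzBr.
Qed.

HB.instance Definition _ :=
  GRing.isZmodMorphism.Build {malg int[K]} U linext linext_is_zmod_morphism.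

Lemma linext0 : linext 0 = 0. Proof. exact: raddf0. Qed.

Lemma linextD : {morph linext : a b / a + b}. Proof. exact: raddfD. Qed.

Lemma linextB : {morph linext : a b / a - b}. Proof. exact: raddfB. Qed.

Lemma linext_sum (J : Type) (r : seq J) (P : pred J) (a : J -> {malg int[K]}) :
  linext (\sum_(j <- r | P j) a j) = \sum_(j <- r | P j) linext (a j).
Proof. exact: raddf_sum. Qed.

Lemma linextUn k c : linext << c *g k >> = e k *~ c.
Proof. by rewrite (linextEw msuppU_le) big_seq_fset1 mcoeffUU. Qed.

Lemma linextU k : linext << k >> = e k.
Proof. by rewrite linextUn. Qed.

Lemma linextU2 k1 k2 : linext (<< k1 >> + << k2 >>) = e k1 + e k2.
Proof. by rewrite linextD !linextU. Qed.

Lemma linextBU2 k1 k2 : linext (<< k1 >> - << k2 >>) = e k1 - e k2.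
Proof. by rewrite raddfB /= !linextU. Qed.

End LinearExtension.

Section LinearExtensionTheory.

Variables (K : choiceType) (U U' : zmodType).

Lemma monalgUMz (k : K) (c : int) : << c *g k >> = << k >> *~ c :> {malg int[K]}.
Proof. by rewrite -raddfMz intz. Qed.

Lemma malg_ind (P : {malg int[K]} -> Prop) :
  P 0 -> (forall k c a, P a -> P (<< c *g k >> + a)) -> forall a, P a.
Proof.
move=> P0 PD a; rewrite (monalgE a); elim: (enum_fset _) => [|k s IHs].
  by rewrite big_nil.
by rewrite big_cons; apply: PD.
Qed.

Lemma linext_comp (g : {additive U -> U'}) (e : K -> U) a :
  g (linext e a) = linext (g \o e) a.
Proof. by rewrite raddf_sum; apply: eq_bigr => k _; rewrite raddfMz. Qed.

Lemma eq_linext (e1 e2 : K -> U) : e1 =1 e2 -> linext e1 =1 linext e2.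
Proof. by move=> ee a; apply: eq_bigr => k _; rewrite ee. Qed.

Lemma linext_id a : linext (fun k : K => << k >>) a = a.
Proof.
by rewrite [RHS]monalgE; apply: eq_bigr => k _; rewrite -monalgUMz.
Qed.

Lemma linextD_fun (e1 e2 : K -> U) a :
  linext (fun k => e1 k + e2 k) a = linext e1 a + linext e2 a.
Proof. by rewrite -big_split; apply: eq_bigr => k _; rewrite mulrzDl. Qed.

Lemma linext_fun0 a : linext (fun _ : K => 0 : U) a = 0.
Proof. by rewrite /linext big1 // => k _; rewrite mul0rz. Qed.

Lemma linextB_fun (e1 e2 : K -> U) a :
  linext (fun k => e1 k - e2 k) a = linext e1 a - linext e2 a.
Proof. by rewrite -sumrB; apply: eq_bigr => k _; rewrite mulrzBl. Qed.

End LinearExtensionTheory.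

Section BilinearForm.

Variables (V : choiceType) (L : V -> V -> int).
Implicit Types a b : {malg int[V]}.

Lemma bilinE a b : bilin L a b = linext (fun v => linext (L v) b) a.
Proof.
apply: eq_bigr => v _; rewrite mulrzz mulr_suml.
by apply: eq_bigr => w _; rewrite mulrzz; ring.
Qed.

Lemma bilinDl a1 a2 b : bilin L (a1 + a2) b = bilin L a1 b + bilin L a2 b.
Proof. by rewrite !bilinE raddfD. Qed.

Fact bilin_is_zmod_morphism a : zmod_morphism (bilin L a).
Proof.
move=> b1 b2; rewrite !bilinE -linextB_fun.
by apply: eq_linext => v; rewrite raddfB.
Qed.

HB.instance Definition _ a := GRing.isZmodMorphism.Build
  {malg int[V]} int (bilin L a) (bilin_is_zmod_morphism a).

Lemma bilinDr a b1 b2 : bilin L a (b1 + b2) = bilin L a b1 + bilin L a b2.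
Proof. exact: raddfD. Qed.

Lemma bilinUl v c b : bilin L << c *g v >> b = c * linext (L v) b.
Proof. by rewrite bilinE linextUn mulrzz mulrC. Qed.

Lemma bilinUU v w : bilin L << v >> << w >> = L v w.
Proof. by rewrite bilinUl linextU mul1r. Qed.

Lemma bilinEw (s : {fset V}) a b :
  (msupp a `<=` s)%fset -> (msupp b `<=` s)%fset ->
  bilin L a b = \sum_(v <- s) \sum_(w <- s) a@_v * b@_w * L v w.
Proof.
move=> sa sb; rewrite bilinE (linextEw _ sa); apply: eq_bigr => v _.
by rewrite (linextEw _ sb) mulrzz mulr_suml; apply: eq_bigr => w _; rewrite mulrzz; ring.
Qed.

Lemma bilinU1U2 v w1 w2 :
  bilin L << v >> (<< w1 >> + << w2 >>) = L v w1 + L v w2.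
Proof. by rewrite bilinDr !bilinUU. Qed.

Lemma bilinU2U1 v1 v2 w :
  bilin L (<< v1 >> + << v2 >>) << w >> = L v1 w + L v2 w.
Proof. by rewrite bilinDl !bilinUU. Qed.

Lemma bilinU2U2 v1 v2 w1 w2 :
  bilin L (<< v1 >> + << v2 >>) (<< w1 >> + << w2 >>) =
  L v1 w1 + L v1 w2 + (L v2 w1 + L v2 w2).
Proof. by rewrite bilinDl !bilinU1U2. Qed.

Hypothesis skewL : forall v w, L w v = - L v w.

Lemma bilin_skew a b : bilin L b a = - bilin L a b.
Proof.
rewrite !bilinE; elim/malg_ind: a => [|v c a IH].
  by rewrite linext0 oppr0 (eq_linext (fun v => linext0 (L v))) linext_fun0.
rewrite (eq_linext (fun w => linextD (L w) _ _)) linextD_fun IH linextD opprD.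
congr (_ + _); rewrite linextUn (eq_linext (fun w => linextUn (L w) v c)).
elim/malg_ind: b {IH} => [|w c' b IH]; first by rewrite !linext0 mul0rz oppr0.
rewrite !linextD mulrzDl opprD IH !linextUn skewL; congr (_ + _).
by rewrite !mulrzz; ring.
Qed.

End BilinearForm.

(** * Bar-invariant monomials *)

Lemma qcommXr (F : unitRingType) (c y z : F) (n : int) :
  c \is a GRing.unit -> z \is a GRing.unit -> (forall u, c * u = u * c) ->
  y * z = c * (z * y) -> y * z ^ n = c ^ n * (z ^ n * y).
Proof.
move=> cU zU cC yz.
have cXC m u : c ^ m * u = u * c ^ m by apply/esym/commrXz/esym/cC.
have pos (m : nat) : y * z ^ m = c ^ m * (z ^ m * y).
  elim: m => [|m IH]; first by rewrite !expr0z !mul1r mulr1.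
  rewrite !exprSz mulrA yz -[c * (z * y) * _]mulrA -[z * y * _]mulrA IH.
  by rewrite -!mulrA; congr (_ * _); rewrite !mulrA cXC.
case: n => m //; rewrite NegzE; have := pos m.+1; move: (m.+1) => k yk.
(* For a negative power, the rule for z^k is solved for y, which leaves y z^(-k) as the unknown. *)
have e : y = c ^ k * (z ^ k * (y * z ^ (- k%:Z))).
  by rewrite !mulrA -[_ * _ * y]mulrA -yk -mulrA -exprzDr // subrr expr0z mulr1.
rewrite [in RHS]e [z ^ _ * (c ^ _ * _)]mulrA -cXC !mulrA -exprzDr // addNr.
by rewrite expr0z mul1r -exprzDr // addNr expr0z mul1r.
Qed.

Lemma qcommXX (F : unitRingType) (c y z : F) (m n : int) :
  c \is a GRing.unit -> y \is a GRing.unit -> z \is a GRing.unit ->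
  (forall u, c * u = u * c) ->
  y * z = c * (z * y) -> y ^ m * z ^ n = c ^ (m * n) * (z ^ n * y ^ m).
Proof.
move=> cU yU zU cC /(qcommXr n cU zU cC) yz.
have cXC k u : c ^ k * u = u * c ^ k by apply/esym/commrXz/esym/cC.
(* Exchanging the roles of y and z inverts the scalar, so the one-sided rule applies again with
   c^(-n) in place of c. *)
have zy : z ^ n * y = c ^ (- n) * (y * z ^ n).
  by rewrite yz mulrA -exprzDr // addNr expr0z mul1r.
have := qcommXr m (unitrXz _ cU) yU (cXC _) zy => ->.
by rewrite exprz_exp mulrA -exprzDr // (_ : _ + _ = 0) ?mul1r //; ring.
Qed.

Section QuantumMonomials.

Variables (V : choiceType) (F : unitRingType).
Variables (L : V -> V -> int) (h : F) (x : V -> F).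
Hypothesis skewL : forall v w, L w v = - L v w.
Hypothesis hU : h \is a GRing.unit.
Hypothesis hC : forall u, h * u = u * h.
Hypothesis xU : forall v, x v \is a GRing.unit.
Hypothesis xC : forall v w, x v * x w = h ^ (2 * L v w) * (x w * x v).
Implicit Types a b : {malg int[V]}.

Lemma hXC m u : h ^ m * u = u * h ^ m.
Proof. exact/esym/commrXz/esym/hC. Qed.

(* For s duplicate-free and containing the support of a, this is qmonomial L h x a. *)
Let mon (s : seq V) a : F :=
  h ^ (- ordered_form L a s) * \prod_(v <- s) x v ^ a@_v.

Lemma prod_qcomm (s : seq V) a v m :
  (\prod_(w <- s) x w ^ a@_w) * x v ^ m =
  h ^ (2 * m * \sum_(w <- s) a@_w * L w v) *
    (x v ^ m * \prod_(w <- s) x w ^ a@_w).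
Proof.
elim: s => [|w s IH]; first by rewrite !big_nil mulr0 expr0z !mul1r mulr1.
rewrite !big_cons -mulrA IH mulrA -hXC -!mulrA; rewrite [x w ^ _ * _]mulrA.
rewrite (qcommXX _ _ (unitrXz _ hU) (xU w) (xU v) (hXC _) (xC w v)).
rewrite !mulrA exprz_exp -exprzDr // -!mulrA; congr (h ^ _ * _); ring.
Qed.

(** Induction on s: the power of x v in the second factor moves left across the first product, and
    skew-symmetry splits the resulting scalar between the bilinear form and the normalisation of a +
    b. *)
Lemma monM s a b :
  mon s a * mon s b =
  h ^ (\sum_(v <- s) \sum_(w <- s) a@_v * b@_w * L v w) * mon s (a + b).
Proof.
rewrite /mon; elim: s => [|v s IH].
  by rewrite /= !big_nil oppr0 expr0z !mul1r.
rewrite /= !big_cons.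
set A := \prod_(w <- s) x w ^ a@_w in IH *.
set B := \prod_(w <- s) x w ^ b@_w in IH *.
set C := \prod_(w <- s) _ in IH *.
have IH' : A * B = h ^ (\sum_(v <- s) \sum_(w <- s) a@_v * b@_w * L v w
    - ordered_form L (a + b) s + ordered_form L a s + ordered_form L b s) * C.
  have E p q : h ^ (- p) * A * (h ^ (- q) * B) = h ^ (- (p + q)) * (A * B).
    by rewrite opprD exprzDr // -!mulrA [A * (h ^ _ * _)]mulrA -hXC -!mulrA.
  have eAB p : A * B = h ^ p * (h ^ (- p) * (A * B)).
    by rewrite mulrA -exprzDr // subrr expr0z mul1r.
  rewrite (eAB (ordered_form L a s + ordered_form L b s)) -E IH.
  by rewrite !mulrA -!exprzDr //; congr (h ^ _ * _); ring.
have hXCA u m w : u * (h ^ m * w) = h ^ m * (u * w).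
  by rewrite mulrA -hXC -mulrA.
rewrite -!mulrA !(hXCA A) [A * (x v ^ _ * _)]mulrA prod_qcomm -/A -!mulrA IH'.
rewrite mcoeffD (exprzDr (xU v)) !(hXCA (x v ^ _)) -!mulrA.
rewrite !mulrA -!exprzDr // -!mulrA; congr (h ^ _ * _).
have Lvv : L v v = 0 by have := skewL v v; lia.
have -> : \sum_(w <- s) \sum_(w' <- v :: s) a@_w * b@_w' * L w w' =
    b@_v * (\sum_(w <- s) a@_w * L w v)
      + \sum_(w <- s) \sum_(w' <- s) a@_w * b@_w' * L w w'.
  rewrite mulr_sumr -big_split; apply: eq_bigr => w _; rewrite big_cons /=; ring.
have -> : \sum_(w <- s) (a@_v + b@_v) * (a + b)@_w * L v w =
    \sum_(w <- s) a@_v * a@_w * L v w + \sum_(w <- s) b@_v * b@_w * L v w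
    + \sum_(w <- s) a@_v * b@_w * L v w - b@_v * \sum_(w <- s) a@_w * L w v.
  rewrite mulr_sumr -!big_split /= -sumrB; apply: eq_bigr => w _.
  rewrite !mcoeffD (skewL v w); ring.
by rewrite Lvv; ring.
Qed.

(* Multiplicativity determines the monomials, so mon s a does not depend on s. *)
Let mon_char (N : {malg int[V]} -> F) (s : seq V) a :
  N 0 = 1 -> (forall v c, v \in s -> N << c *g v >> = x v ^ c) ->
  (forall v c (r : seq V) b, v \in s -> {subset r <= s} ->
     N << c *g v >> * N (\sum_(w <- r) << b@_w *g w >>) =
     h ^ bilin L << c *g v >> (\sum_(w <- r) << b@_w *g w >>)
       * N (<< c *g v >> + \sum_(w <- r) << b@_w *g w >>)) ->
  N (\sum_(w <- s) << a@_w *g w >>) = mon s a.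
Proof.
move=> N0 NU NM; rewrite /mon.
have {}NM : forall v c (r : seq V), v \in s -> {subset r <= s} ->
    N (<< c *g v >> + \sum_(w <- r) << a@_w *g w >>) =
    h ^ (- \sum_(w <- r) c * a@_w * L v w) * (x v ^ c * N (\sum_(w <- r) << a@_w *g w >>)).
  move=> v c r vs rs; rewrite -NU // NM // mulrA -exprzDr //.
  rewrite (_ : - _ + _ = 0) ?expr0z ?mul1r // addrC; apply/eqP.
  rewrite subr_eq0; apply/eqP; rewrite bilinUl (raddf_sum (linext (L v))).
  by rewrite mulr_sumr; apply: eq_bigr => w _; rewrite /= linextUn mulrzz; ring.
have: {subset s <= s} by [].
(* The induction runs over a list r contained in s, while s stays fixed as the set on which the
   hypotheses on N hold. *)
elim: {1 3 4 5}s => [|v r IH] rs; first by rewrite !big_nil N0 oppr0 mul1r.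
have vs : v \in s by apply/rs/mem_head.
have rs' : {subset r <= s} by move=> w wr; apply/rs; rewrite inE wr orbT.
rewrite !big_cons NM // IH //= opprD exprzDr // -!mulrA; congr (_ * _).
by rewrite !mulrA hXC.
Qed.

Lemma qmonomial0 : qmonomial L h x 0 = 1.
Proof. by rewrite /qmonomial msupp0 /= !big_nil oppr0 expr0z mulr1. Qed.

Lemma qmonomialUn v c : qmonomial L h x << c *g v >> = x v ^ c.
Proof.
have e : enum_fset [fset v]%fset = [:: v].
  apply: perm_small_eq => //; apply: uniq_perm => // w.
  by rewrite !inE.
rewrite /qmonomial msuppU; case: eqVneq => [->|_].
  by rewrite /= big_nil oppr0 !expr0z mul1r.
by rewrite e /= big_seq1 mcoeffUU big_nil addr0 oppr0 expr0z mul1r.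
Qed.

Lemma qmonomialU v : qmonomial L h x << v >> = x v.
Proof. exact: qmonomialUn. Qed.

Let monUn (s : {fset V}) v c : v \in s -> mon s << c *g v >> = x v ^ c.
Proof.
move=> vs; have Lvv : L v v = 0 by have := skewL v v; lia.
(* Each term vanishes: either some coordinate is taken off v, or both indices are v and L v v =
   0. *)
have o0 : ordered_form L << c *g v >> s = 0.
  elim: (enum_fset s) => //= w r ->; rewrite addr0 big1 // => u _.
  rewrite !mcoeffU; case: eqVneq => [<-|_]; last by rewrite !mul0r.
  by case: eqVneq => [<-|_]; rewrite ?Lvv !(mulr0, mul0r).
rewrite /mon o0 oppr0 expr0z mul1r; move: (fset_uniq s) vs.
rewrite -[v \in s]/(v \in enum_fset s); move: (enum_fset s) => r ur vr.
have out r' : v \notin r' -> \prod_(w <- r') x w ^ << c *g v >>@_w = 1.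
  move=> vr'; rewrite big_seq big1 // => w wr'; rewrite mcoeffU.
  by case: eqVneq wr' vr' => [<- ->|_ _ _]; rewrite ?expr0z.
case/splitPr: vr ur => r1 r2; rewrite cat_uniq /= negb_or.
case/and3P=> _ /andP[vr1 _] /andP[vr2 _].
by rewrite big_cat big_cons /= !out // mcoeffUU mul1r mulr1.
Qed.

(** For fixed s, [mon s] meets the hypotheses of [mon_char] along the support of a. Two exponents
    can thus be written over a common s, as [monM] requires. *)
Let qmonomialEw (s : {fset V}) a :
  (msupp a `<=` s)%fset -> qmonomial L h x a = mon s a.
Proof.
move=> sa; rewrite /qmonomial -/(mon (msupp a) a) [in RHS](monalgE a).
apply/esym/mon_char => [|v c /(fsubsetP sa) vs|v c r b va ra].
- have o0 : ordered_form L 0 s = 0.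
    elim: (enum_fset s) => //= w r ->; rewrite addr0 big1 // => u _.
    by rewrite mcoeff0 !mul0r.
  by rewrite /mon o0 oppr0 expr0z mul1r big1 // => v _; rewrite mcoeff0 expr0z.
- exact: monUn.
rewrite monM -bilinEw //; apply/fsubsetP => w.
  by move/(fsubsetP msuppU_le); rewrite inE => /eqP ->; apply: (fsubsetP sa).
rewrite -mcoeff_neq0 raddf_sum /= => wr; apply: (fsubsetP sa); apply: ra.
apply: contraNT wr => wr; rewrite big_seq big1 // => u ur.
by rewrite mcoeffU; case: eqVneq ur wr => // <- ->.
Qed.

(** The product rule of the quantum torus; h = t^(1/2) absorbs the usual factor 1/2. *)
Lemma qmonomialM a b :
  qmonomial L h x a * qmonomial L h x b =
  h ^ bilin L a b * qmonomial L h x (a + b).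
Proof.
pose s := (msupp a `|` msupp b)%fset.
have sa : (msupp a `<=` s)%fset by apply: fsubsetUl.
have sb : (msupp b `<=` s)%fset by apply: fsubsetUr.
by rewrite !(@qmonomialEw s) ?msuppD_le // monM -bilinEw.
Qed.

Lemma qmonomial_unit a : qmonomial L h x a \is a GRing.unit.
Proof.
rewrite /qmonomial unitrMl ?unitrXz //; elim: (enum_fset _) => [|v s IH].
  by rewrite big_nil unitr1.
by rewrite big_cons unitrMl ?unitrXz.
Qed.

(** Serves to recognise bar-invariant monomials after a change of variables. Since L v v = 0, N is
    multiplicative on the multiples of v, and this fixes its values there, negative multiples
    included. *)
Lemma qmonomial_char (N : {malg int[V]} -> F) :
  N 0 = 1 -> (forall v, N << v >> = x v) ->
  (forall a b, N a * N b = h ^ bilin L a b * N (a + b)) ->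
  forall a, qmonomial L h x a = N a.
Proof.
move=> N0 NU NM a; rewrite [in RHS](monalgE a) -/(mon (msupp a) a).
apply/esym/mon_char => // v c _.
have Nv m n : N << m + n *g v >> = N << m *g v >> * N << n *g v >>.
  have Lvv : L v v = 0 by have := skewL v v; lia.
  by rewrite NM bilinUl linextUn Lvv mul0rz mulr0 expr0z mul1r monalgUD.
have pos (n : nat) : N << n%:Z *g v >> = x v ^ n.
  elim: n => [|n IH]; first by rewrite raddf0 N0 expr0z.
  by rewrite intS Nv NU IH exprSz.
case: c => n; first exact: pos.
rewrite NegzE; apply: (mulIr (unitrXz n.+1 (xU v))).
by rewrite -exprzDr // -pos -Nv addNr raddf0 N0 expr0z.
Qed.

End QuantumMonomials.

(** * Skew fields of fractions *)

Section OreFractions.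

Variables (T : zmodType) (one : T) (mul : T -> T -> T).
Implicit Types P Q A B D : T.

(** A localisation of T seen from outside: T carries only a unit and a product, and the ring laws in
    use are read off the injective map [ev]. *)
Record fraction_eval (F : unitRingType) (ev : T -> F) : Prop := FractionEval {
  fe_division : forall u : F, u != 0 -> u \is a GRing.unit;
  fe_B : zmod_morphism ev;
  fe_1 : ev one = 1;
  fe_M : forall P Q, ev (mul P Q) = ev P * ev Q;
  fe_free : forall P, ev P = 0 -> P = 0;
  fe_fraction : forall u, exists P Q, Q != 0 /\ u = ev P / ev Q }.

Section OneField.

Variables (F : unitRingType) (ev : T -> F).
Hypothesis hF : fraction_eval ev.

Lemma fe_0 : ev 0 = 0.
Proof. by rewrite -(subrr 0) (fe_B hF) subrr. Qed.

Lemma fe_inj : injective ev.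
Proof.
move=> P Q PQ; apply/eqP; rewrite -subr_eq0; apply/eqP/(fe_free hF).
by rewrite (fe_B hF) PQ subrr.
Qed.

Lemma fe_unit P : P != 0 -> ev P \is a GRing.unit.
Proof.
by move=> P0; apply: (fe_division hF); apply: contra_neq P0 => /(fe_free hF).
Qed.

Lemma fe_mul_neq0 P Q : P != 0 -> Q != 0 -> mul P Q != 0.
Proof.
move=> /fe_unit Pu /fe_unit Qu.
have: ev (mul P Q) \is a GRing.unit by rewrite (fe_M hF) unitrMl.
by apply: contraTneq => ->; rewrite fe_0 unitr0.
Qed.

Lemma fe_mul0 P : mul P 0 = 0.
Proof. by apply: fe_inj; rewrite (fe_M hF) fe_0 mulr0. Qed.

Lemma fe_one_neq0 : one != 0.
Proof. by apply: contra_eq_neq (fe_1 hF) => ->; rewrite fe_0 eq_sym oner_eq0. Qed.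

(* The right Ore condition, read off the fraction Q^-1 P = A B^-1. *)
Lemma fe_ore P Q : Q != 0 -> exists A B, B != 0 /\ mul P B = mul Q A.
Proof.
move=> /fe_unit Qu; have [A [B [B0 e]]] := fe_fraction hF ((ev Q)^-1 * ev P).
exists A, B; split=> //; apply: fe_inj; rewrite !(fe_M hF).
have Bu := fe_unit B0; have Qu' : (ev Q)^-1 \is a GRing.unit by rewrite unitrV.
by apply: (mulrI Qu'); rewrite mulrA e divrK // mulKr.
Qed.

Lemma fe_ore_neq0 P Q A B :
  P != 0 -> B != 0 -> mul P B = mul Q A -> A != 0.
Proof.
move=> P0 B0 e; have := fe_mul_neq0 P0 B0; apply: contraNneq => A0.
by rewrite e A0 fe_mul0.
Qed.

Lemma fe_divMr P Q B :
  Q != 0 -> B != 0 -> ev (mul P B) / ev (mul Q B) = ev P / ev Q.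
Proof.
move=> /fe_unit Qu /fe_unit Bu.
by rewrite !(fe_M hF) invrM // mulrA mulrK.
Qed.

(** An Ore pair with Q' B = Q A expands the first fraction by A and the second by B. *)
Lemma fe_common_denominator u w :
  exists P P' D, [/\ D != 0, u = ev P / ev D & w = ev P' / ev D].
Proof.
have [P [Q [Q0 ->]]] := fe_fraction hF u.
have [P' [Q' [Q'0 ->]]] := fe_fraction hF w.
have [A [B [B0 e]]] := fe_ore Q' Q0.
have A0 := fe_ore_neq0 Q'0 B0 e.
exists (mul P A), (mul P' B), (mul Q' B); split; first exact: fe_mul_neq0.
  by rewrite e fe_divMr.
by rewrite fe_divMr.
Qed.

(** The hypothesis P' B = Q A says that Q^-1 P' = A B^-1 in the field. *)
Lemma fe_mul_fractions P Q P' Q' A B :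
  Q != 0 -> Q' != 0 -> B != 0 -> mul P' B = mul Q A ->
  ev P / ev Q * (ev P' / ev Q') = ev (mul P A) / ev (mul Q' B).
Proof.
move=> /fe_unit Qu /fe_unit Q'u /fe_unit Bu /(congr1 ev).
rewrite !(fe_M hF) => e; rewrite -!mulrA; congr (_ * _).
by apply: (mulrI Qu); rewrite invrM // mulVKr // [RHS]mulrA -e -!mulrA mulVKr.
Qed.

End OneField.

Section TwoFields.

Variables (F1 F2 : unitRingType) (ev1 : T -> F1) (ev2 : T -> F2).
Hypotheses (hF1 : fraction_eval ev1) (hF2 : fraction_eval ev2).

(** Over a common denominator, equality of fractions becomes equality of numerators in T, which no
    longer refers to the field. *)
Lemma fe_fraction_transfer P Q P' Q' :
  Q != 0 -> Q' != 0 ->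
  ev1 P / ev1 Q = ev1 P' / ev1 Q' -> ev2 P / ev2 Q = ev2 P' / ev2 Q'.
Proof.
move=> Q0 Q'0 e; have [A [B [B0 eD]]] := fe_ore hF1 Q' Q0.
have A0 := fe_ore_neq0 hF1 Q'0 B0 eD.
rewrite -(fe_divMr hF1 P Q0 A0) -(fe_divMr hF1 P' Q'0 B0) eD in e.
rewrite -(fe_divMr hF2 P Q0 A0) -(fe_divMr hF2 P' Q'0 B0) eD.
congr (ev2 _ / _); apply: (fe_inj hF1); apply: mulIr e.
by rewrite unitrV (fe_unit hF1) // (fe_mul_neq0 hF1).
Qed.

Lemma fe_morphism :
  exists Phi : {rmorphism F1 -> F2},
    forall P Q, Q != 0 -> Phi (ev1 P / ev1 Q) = ev2 P / ev2 Q.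
Proof.
(* Quantifying over all representations of u builds well-definedness into the function extracted by
   [choice]. *)
have ex u : exists w, forall P Q, Q != 0 -> u = ev1 P / ev1 Q -> w = ev2 P / ev2 Q.
  have [P [Q [Q0 ->]]] := fe_fraction hF1 u; exists (ev2 P / ev2 Q) => P' Q' Q'0.
  exact: fe_fraction_transfer.
have [Phi PhiP] := choice ex.
have PhiE P Q : Q != 0 -> Phi (ev1 P / ev1 Q) = ev2 P / ev2 Q.
  by move=> Q0; apply: PhiP.
have PhiB : zmod_morphism Phi.
  move=> u w; have [P [P' [D [D0 -> ->]]]] := fe_common_denominator hF1 u w.
  by rewrite -mulrBl -(fe_B hF1) !PhiE // (fe_B hF2) mulrBl.
have PhiM : monoid_morphism Phi.
  split.
    have := PhiE one one (fe_one_neq0 hF1).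
    by rewrite (fe_1 hF1) (fe_1 hF2) !divr1.
  move=> u w; have [P [Q [Q0 ->]]] := fe_fraction hF1 u.
  have [P' [Q' [Q'0 ->]]] := fe_fraction hF1 w.
  (* The Ore pair lives in T, so the same A and B compute the product in both fields. *)
  have [A [B [B0 e]]] := fe_ore hF1 P' Q0.
  rewrite (fe_mul_fractions hF1 P Q0 Q'0 B0 e) !PhiE //.
    by rewrite (fe_mul_fractions hF2 P Q0 Q'0 B0 e).
  exact: (fe_mul_neq0 hF1).
pose PhiZ := GRing.isZmodMorphism.Build F1 F2 Phi PhiB.
pose PhiR := GRing.isMonoidMorphism.Build F1 F2 Phi PhiM.
pose Phi' : {rmorphism F1 -> F2} := HB.pack Phi PhiZ PhiR.
by exists Phi'.
Qed.

End TwoFields.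

Lemma fe_iso (F1 F2 : unitRingType) (ev1 : T -> F1) (ev2 : T -> F2) :
  fraction_eval ev1 -> fraction_eval ev2 ->
  exists (Phi : {rmorphism F1 -> F2}) (Psi : {rmorphism F2 -> F1}),
    [/\ cancel Phi Psi, cancel Psi Phi & forall P, Phi (ev1 P) = ev2 P].
Proof.
move=> hF1 hF2.
have [Phi PhiE] := fe_morphism hF1 hF2.
have [Psi PsiE] := fe_morphism hF2 hF1.
exists Phi, Psi; split=> [u|u|P].
- by have [P [Q [Q0 ->]]] := fe_fraction hF1 u; rewrite PhiE // PsiE.
- by have [P [Q [Q0 ->]]] := fe_fraction hF2 u; rewrite PsiE // PhiE.
have := PhiE P one (fe_one_neq0 hF1).
by rewrite (fe_1 hF1) (fe_1 hF2) !divr1.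
Qed.

End OreFractions.

(** * The quantum torus and the uniqueness of its skew field of fractions *)

Section QuantumTorus.

Variables (V : choiceType) (L : V -> V -> int).
Hypothesis skewL : forall v w, L w v = - L v w.

Local Notation torus := {malg int[(int * {malg int[V]})%type]}.
Implicit Types P Q : torus.

(** Multiplication in the basis t^(k/2) M^a, where M^a M^b = t^(L(a,b)/2) M^(a+b). *)
Definition torus_mul P Q : torus :=
  linext (fun p => linext (fun q =>
    << (p.1 + q.1 + bilin L p.2 q.2, p.2 + q.2) >>) Q) P.

Lemma qtorus_evalU (F : unitRingType) (h : F) (x : V -> F) k a :
  qtorus_eval L h x << (k, a) >> = h ^ k * qmonomial L h x a.
Proof. exact: (linextU (fun p => h ^ p.1 * qmonomial L h x p.2)). Qed.

Lemma qtorus_fraction_eval (F : unitRingType) (h : F) (x : V -> F) :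
  qtorus_fraction_field L h x ->
  fraction_eval << (0, 0) >> torus_mul (qtorus_eval L h x).
Proof.
move=> hF; have hU := qff_division hF (qff_h_neq0 hF); have hC := qff_central hF.
have xU v : x v \is a GRing.unit by apply: qff_division hF _ (qff_x_neq0 hF v).
split; [exact: (qff_division hF) | | | | exact: (qff_free hF) | exact: (qff_fraction hF)].
- exact: (linext_is_zmod_morphism (fun p => h ^ p.1 * qmonomial L h x p.2)).
- by rewrite qtorus_evalU expr0z mul1r qmonomial0.
move=> P Q; rewrite /torus_mul.
pose ev := linext (fun p : int * {malg int[V]} => h ^ p.1 * qmonomial L h x p.2).
rewrite -![qtorus_eval L h x _]/(ev _) /ev !linext_comp mulr_suml.
apply: eq_bigr => p _; rewrite mulrzAl; congr (_ *~ _) => /=.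
rewrite linext_comp mulr_sumr.
apply: eq_bigr => q _; rewrite mulrzAr; congr (_ *~ _) => /=.
rewrite linextU /=; have := qmonomialM skewL hU hC xU (qff_comm hF) p.2 q.2.
move: (qmonomial L h x p.2) (qmonomial L h x q.2) => M1 M2.
move: (qmonomial _ _ _ _) => M3 e.
by rewrite -!mulrA [M1 * _]mulrA -(hXC hC) -!mulrA e !mulrA -!exprzDr.
Qed.

Lemma qtorus_fraction_field_iso (F1 F2 : unitRingType) (h1 : F1) (h2 : F2)
    (x1 : V -> F1) (x2 : V -> F2) :
  qtorus_fraction_field L h1 x1 -> qtorus_fraction_field L h2 x2 ->
  exists (Phi : {rmorphism F1 -> F2}) (Psi : {rmorphism F2 -> F1}),
    [/\ cancel Phi Psi, cancel Psi Phi, Phi h1 = h2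
      & forall v, Phi (x1 v) = x2 v].
Proof.
move=> hF1 hF2.
have [Phi [Psi [PhiK PsiK PhiE]]] :=
  fe_iso (qtorus_fraction_eval hF1) (qtorus_fraction_eval hF2).
exists Phi, Psi; split=> //.
  by have := PhiE << (1, 0) >>; rewrite !qtorus_evalU !qmonomial0 !mulr1 !expr1z.
move=> v; have := PhiE << (0, << v >>) >>.
by rewrite !qtorus_evalU !expr0z !mul1r !qmonomialU.
Qed.

End QuantumTorus.

(** * Monomial changes of variables *)

Section ChangeOfVariables.

Variables (V W : choiceType) (L : W -> W -> int).
Hypothesis skewL : forall v w, L w v = - L v w.
Variables (e : V -> {malg int[W]}) (e' : W -> {malg int[V]}).
Hypothesis eK : forall v, linext e' (e v) = << v >>.
Hypothesis e'K : forall w, linext e (e' w) = << w >>.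

Local Notation Le := (fun v w => bilin L (e v) (e w)).

Lemma bilin_linext a b : bilin Le a b = bilin L (linext e a) (linext e b).
Proof.
rewrite [RHS]bilinE linext_comp bilinE; apply: eq_linext => v /=.
by rewrite -bilinE linext_comp; apply: eq_linext.
Qed.

Let torus (K : choiceType) := {malg int[(int * {malg int[K]})%type]}.
Let act (K K' : choiceType) (g : K -> {malg int[K']}) : torus K -> torus K' :=
  linext (fun p => << (p.1, linext g p.2) >>).

Let actK (K K' : choiceType) (g : K -> {malg int[K']}) (g' : K' -> {malg int[K]}) :
  (forall v, linext g' (g v) = << v >>) -> cancel (act g) (act g').
Proof.
move=> gK P; rewrite /act linext_comp -[RHS]linext_id; apply: eq_linext => -[k a].
by rewrite /= linextU linext_comp /= (eq_linext gK) linext_id.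
Qed.

(** The inverse relabellings [act e] and [act e'] carry one basis of the torus to the other, so
    freeness and the fraction property are transported. *)
Lemma qtorus_fraction_field_change (F : unitRingType) (h : F) (y : W -> F) :
  qtorus_fraction_field L h y ->
  qtorus_fraction_field Le h (fun v => qmonomial L h y (e v)).
Proof.
move=> hF; have hU := qff_division hF (qff_h_neq0 hF); have hC := qff_central hF.
have yU v : y v \is a GRing.unit by apply: qff_division hF _ (qff_x_neq0 hF v).
have yM := qmonomialM skewL hU hC yU (qff_comm hF).
pose x v := qmonomial L h y (e v).
have xU v : x v \is a GRing.unit by apply: qmonomial_unit.
have skewLe v w : Le w v = - Le v w by apply: bilin_skew.
have xC v w : x v * x w = h ^ (2 * Le v w) * (x w * x v).
  rewrite /x !yM mulrA -exprzDr // [bilin L (e w) (e v)](bilin_skew skewL).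
  by rewrite [e w + e v]addrC; congr (h ^ _ * _); ring.
have xE a : qmonomial Le h x a = qmonomial L h y (linext e a).
  apply: (@qmonomial_char _ _ Le h x skewLe hU hC xU
    (fun a => qmonomial L h y (linext e a))) => [|v|b c].
  - by rewrite linext0 qmonomial0.
  - by rewrite linextU.
  - by rewrite yM bilin_linext linextD.
have evE P : qtorus_eval Le h x P = qtorus_eval L h y (act e P).
  pose ev := linext (fun p : int * {malg int[W]} => h ^ p.1 * qmonomial L h y p.2).
  rewrite -[RHS]/(ev _) /ev /act linext_comp; apply: eq_bigr => p _.
  by rewrite /= linextU /= xE.
have act0 (K K' : choiceType) (g : K -> {malg int[K']}) : act g 0 = 0.
  exact: linext0.
split.
- exact: qff_division hF.
- exact: hC.
- exact: qff_h_neq0 hF.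
- by move=> v; apply: contraTneq (xU v) => v0; rewrite /x v0 unitr0.
- exact: xC.
- by move=> P; rewrite evE => /(qff_free hF) P0; rewrite -(actK eK P) P0 act0.
move=> u; have [P [Q [Q0 ->]]] := qff_fraction hF u.
exists (act e' P), (act e' Q); rewrite !evE !(actK e'K); split=> //.
by apply: contra_neq Q0 => Q0; rewrite -(actK e'K Q) Q0 act0.
Qed.

End ChangeOfVariables.

(** * Transport of seeds and cluster algebras along an isomorphism *)

Section ClusterIsomorphism.

Variables (V : choiceType) (F1 F2 : unitRingType).
Variables (Phi : {rmorphism F1 -> F2}) (Psi : {rmorphism F2 -> F1}).
Hypotheses (PhiK : cancel Phi Psi) (PsiK : cancel Psi Phi).

Lemma iso_invr u : Phi u^-1 = (Phi u)^-1.
Proof.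
have [/rmorphV //|uNu] := boolP (u \is a GRing.unit).
(* Off the units [^-1] is the identity; [Psi] shows that [Phi] sends non-units to non-units. *)
rewrite !invr_out //; apply: contraNN uNu => /(rmorph_unit Psi).
by rewrite PhiK.
Qed.

Lemma iso_exprz u (n : int) : Phi (u ^ n) = Phi u ^ n.
Proof. by case: n => n; rewrite /exprz ?iso_invr rmorphXn. Qed.

Lemma iso_qmonomial L h (x : V -> F1) a :
  Phi (qmonomial L h x a) = qmonomial L (Phi h) (Phi \o x) a.
Proof.
rewrite /qmonomial rmorphM rmorph_prod iso_exprz; congr (_ * _).
by apply: eq_bigr => v _; rewrite iso_exprz.
Qed.

Definition map_seed (S : seed V F1) : seed V F2 :=
  Seed (Phi \o cvar S) (exch S) (qform S).

(** The exchange matrix and the form mutate without reference to the field, so only the exchange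
    relation is to be compared. *)
Lemma map_seed_mutate h S v :
  map_seed (mutate h S v) = mutate (Phi h) (map_seed S) v.
Proof.
congr Seed; apply/funext => w; rewrite /= /mutate_var.
by case: ifP => // _; rewrite rmorphD /= !iso_qmonomial.
Qed.

Lemma map_seed_mutates h S s :
  map_seed (foldl (mutate h) S s) = foldl (mutate (Phi h)) (map_seed S) s.
Proof. by elim: s S => //= v s IH S; rewrite IH map_seed_mutate. Qed.

Lemma iso_in_qcluster h mu S invf u :
  in_qcluster h mu S invf u -> in_qcluster (Phi h) mu (map_seed S) invf (Phi u).
Proof.
elim=> [||s v smu|v hi vmu||a b _ IHa _ IHb|a b _ IHa _ IHb].
- exact: in_qcluster_h.
- by rewrite iso_invr; apply: in_qcluster_hV.
- rewrite -[Phi (cvar _ v)]/(cvar (map_seed (foldl (mutate h) S s)) v) map_seed_mutates.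
  exact: in_qcluster_var.
- rewrite iso_invr -[Phi (cvar _ v)]/(cvar (map_seed S) v).
  exact: in_qcluster_frozenV.
- by rewrite rmorph1; apply: in_qcluster1.
- by rewrite rmorphB; apply: in_qclusterB.
- by rewrite rmorphM; apply: in_qclusterM.
Qed.

End ClusterIsomorphism.

Lemma qcluster_iso_map_seed (V : choiceType) (F1 F2 : unitRingType)
    (Phi : {rmorphism F1 -> F2}) (Psi : {rmorphism F2 -> F1})
    (h : F1) (mu : {pred V}) (S : seed V F1) (invf : bool) :
  cancel Phi Psi -> cancel Psi Phi ->
  qcluster_iso h mu S (Phi h) mu (map_seed Phi S) invf.
Proof.
move=> PhiK PsiK.
have SK : map_seed Psi (map_seed Phi S) = S.
  by case: S => c E q; congr Seed; apply/funext => v /=; rewrite PhiK.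
have mem1 (a : qcluster_algebra h mu S invf) :
    Phi (val a) \in qcluster_pred (Phi h) mu (map_seed Phi S) invf.
  by apply/asboolP/(iso_in_qcluster PhiK)/asboolP/(valP a).
have mem2 (a : qcluster_algebra (Phi h) mu (map_seed Phi S) invf) :
    Psi (val a) \in qcluster_pred h mu S invf.
  apply/asboolP; have /asboolP/(iso_in_qcluster PsiK) := valP a.
  by rewrite PhiK SK.
pose f a := QCluster (mem1 a); pose g a := QCluster (mem2 a).
have fB : zmod_morphism f.
  by move=> a b; apply/val_inj; rewrite /= rmorphB.
have fM : monoid_morphism f.
  split; first by apply/val_inj; rewrite /= rmorph1.
  by move=> a b; apply/val_inj; rewrite /= rmorphM.
pose fZ := GRing.isZmodMorphism.Build _ _ f fB.
pose fR := GRing.isMonoidMorphism.Build _ _ f fM.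
pose f' : {rmorphism qcluster_algebra h mu S invf ->
  qcluster_algebra (Phi h) mu (map_seed Phi S) invf} := HB.pack f fZ fR.
exists f'; split; last exact/val_inj.
by exists g => a; apply/val_inj; rewrite /= ?PhiK ?PsiK.
Qed.

(** * The matrices L and Lambda *)

Section CartanCombinatorics.

Variables (X : dynkin) (xi : 'I_(rank X) -> bool).
Hypothesis hxi : forall i j, adj i j -> xi i != xi j.
Variable Ct : int -> 'M[int]_(rank X).
Hypothesis hCt : qcartan_inverse Ct.
Local Notation I := 'I_(rank X).
Local Notation calF := (calF Ct).
Local Notation bfC := (bfC Ct).

(** * Coefficients of the inverse quantum Cartan matrix *)

Lemma adj_sym (i j : I) : adj i j = adj j i.
Proof. exact: orbC. Qed.

Lemma adj_irrefl (i : I) : adj i i = false.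
Proof. by apply/negP => /hxi; rewrite eqxx. Qed.

Lemma qcartan1 : qcartan X 1 = 1%:M.
Proof. by apply/matrixP => i j; rewrite !mxE /=; case: eqVneq. Qed.

Lemma qcartanN1 : qcartan X (-1) = 1%:M.
Proof. by apply/matrixP => i j; rewrite !mxE /=; case: eqVneq. Qed.

Lemma qcartan0_sym : (qcartan X 0)^T = qcartan X 0.
Proof.
apply/matrixP => i j; rewrite !mxE /= eq_sym; case: eqVneq => // _.
by rewrite adj_sym.
Qed.

Lemma Ct_le0 m : m <= 0 -> Ct m = 0.
Proof. by case: hCt => + _ _; apply. Qed.

Lemma Ct_recl m :
  Ct (m + 1) + qcartan X 0 *m Ct m + Ct (m - 1) = (m == 0)%:R%:M.
Proof.
case: hCt => _ /(_ m) + _; rewrite !big_cons big_nil.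
by rewrite opprK subr0 qcartan1 qcartanN1 !mul1mx addr0 addrA.
Qed.

Lemma Ct_recr m :
  Ct (m + 1) + Ct m *m qcartan X 0 + Ct (m - 1) = (m == 0)%:R%:M.
Proof.
case: hCt => _ _ /(_ m); rewrite !big_cons big_nil.
by rewrite opprK subr0 qcartan1 qcartanN1 !mulmx1 addr0 addrA.
Qed.

(** The transpose of the right recurrence is the left one, since C(z) is symmetric; strong induction
    then compares the leading terms. *)
Lemma Ct_tr m : (Ct m)^T = Ct m.
Proof.
have [/Ct_le0->|] := lerP m 0; first exact: trmx0.
case: m => // m _; elim/ltn_ind: m => -[_|m IH]; first by rewrite Ct_le0 ?trmx0.
have Cl := Ct_recl m; have Cr := congr1 trmx (Ct_recr m).
have e1 : m%:Z + 1 = m.+1 by lia.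
rewrite e1 in Cl Cr; rewrite !linearD /= trmx_mul qcartan0_sym tr_scalar_mx in Cr.
have sm : (Ct m)^T = Ct m by apply: IH.
have sm1 : (Ct (m%:Z - 1))^T = Ct (m%:Z - 1).
  case: m IH {Cl Cr e1 sm} => [|m] IH; first by rewrite Ct_le0 ?trmx0.
  have -> : m.+1%:Z - 1 = m by lia.
  exact/IH/leqnSn.
by rewrite sm sm1 -Cl in Cr; move/addIr/addIr: Cr.
Qed.

Lemma Ct_sym m i j : Ct m i j = Ct m j i.
Proof. by rewrite -[in LHS]Ct_tr mxE. Qed.

Lemma Ct_recE m i k :
  Ct (m + 1) i k + Ct (m - 1) i k =
  ((m == 0) && (i == k))%:R + \sum_(j | adj i j) Ct m j k.
Proof.
have /matrixP/(_ i k) := Ct_recl m; rewrite !mxE.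
have -> : \sum_j qcartan X 0 i j * Ct m j k = - \sum_(j | adj i j) Ct m j k.
  rewrite [in RHS]big_mkcond /= -sumrN; apply: eq_bigr => j _; rewrite !mxE /=.
  case: eqVneq => [<-|_]; first by rewrite adj_irrefl mul0r oppr0.
  by case: ifP => _; rewrite ?mulN1r ?mul0r ?oppr0.
have -> : (m == 0)%:R *+ (i == k) = ((m == 0) && (i == k))%:R :> int.
  by case: (m == 0); case: (i == k).
by move=> <-; ring.
Qed.

(** The recurrences at m and -m are added; both contribute at m = 0, whence the factor 2. *)
Lemma bfC_rec m i k :
  bfC i k (m + 1) + bfC i k (m - 1) =
  2 * ((m == 0) && (i == k))%:R + \sum_(j | adj i j) bfC j k m.
Proof.
have := Ct_recE m i k; have := Ct_recE (- m) i k.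
rewrite oppr_eq0 /Defs.bfC big_split /= => e1 e2.
have -> : - (m + 1) = - m - 1 by lia.
have -> : - (m - 1) = - m + 1 by lia.
by rewrite addrACA e2 [Ct (- m - 1) i k + _]addrC e1; ring.
Qed.

(** * The odd function F and its differences of step 2 *)

Lemma calF_natSS i j n :
  calF_nat Ct i j n.+2 = calF_nat Ct i j n - Ct n.+1 i j.
Proof.
rewrite /calF_nat big_mkcond big_ltn //= big_add1 /=.
rewrite big_nat_recr //= [X in - X - _]big_mkcond /=.
(* After the shift of k, the term k = 1 has split off as the new coefficient, and the last index n +
   3 fails the bound. *)
have -> : (2 * n.+3 - 1 <= n.+2)%N = false by lia.
have -> : n.+2%:Z - 2 * 1%:Z + 1 = n.+1 by lia.
rewrite addr0 opprD addrC; congr (- _ - _).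
apply: eq_bigr => k _; have -> : (2 * k.+1 - 1 <= n.+2)%N = (2 * k - 1 <= n)%N.
  by lia.
by have -> : n.+2%:Z - 2 * k.+1%:Z + 1 = n%:Z - 2 * k%:Z + 1 by lia.
Qed.

Lemma calF_nat_small i j n : (n <= 1)%N -> calF_nat Ct i j n = 0.
Proof.
move=> n1; rewrite /calF_nat big1_seq ?oppr0 // => k /andP[_].
rewrite mem_index_iota => /andP[k1 _].
by rewrite Ct_le0 ?mxE //; lia.
Qed.

Lemma calF_sym i j m : calF i j m = calF j i m.
Proof.
have nat_sym n : calF_nat Ct i j n = calF_nat Ct j i n.
  by congr (- _); apply: eq_bigr => k _; apply: Ct_sym.
by rewrite /Defs.calF !nat_sym.
Qed.

Lemma calF_nat_pos i j (n : nat) : calF i j n = calF_nat Ct i j n.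
Proof. by []. Qed.

Lemma calF_odd i j m : calF i j (- m) = - calF i j m.
Proof.
case: m => [[|n]|n]; rewrite /Defs.calF /=; first by rewrite calF_nat_small.
  by [].
by rewrite opprK.
Qed.

Lemma calF_step i j m : calF i j (m + 2) = calF i j m - bfC i j (m + 1).
Proof.
have pos (n : nat) : calF i j (n%:Z + 2) = calF i j n - bfC i j (n%:Z + 1).
  have -> : n%:Z + 2 = n.+2 by lia.
  have e1 : n%:Z + 1 = n.+1 by lia.
  rewrite !calF_nat_pos calF_natSS /Defs.bfC e1 [Ct (- _)]Ct_le0 ?mxE ?addr0 //.
have bfCN k : bfC i j (- k) = bfC i j k by rewrite /Defs.bfC opprK addrC.
(* The step crosses 0 only for m = -1, where all terms vanish; below that, oddness reduces to
   [pos]. *)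
case: m => [n|[|n]]; first exact: pos.
  have -> : Negz 0 + 2 = 1 by [].
  have -> : Negz 0 + 1 = 0 by [].
  rewrite (calF_odd _ _ 1) (calF_nat_pos _ _ 1) calF_nat_small // /Defs.bfC.
  by rewrite !Ct_le0 // !mxE.
have -> : Negz n.+1 + 2 = - n%:Z by lia.
have -> : Negz n.+1 + 1 = - (n%:Z + 1) by lia.
have -> : Negz n.+1 = - (n%:Z + 2) by lia.
by rewrite bfCN !calF_odd pos; ring.
Qed.

Lemma calF_small i j m : `|m| <= 1 -> calF i j m = 0.
Proof.
move=> m1; have [->|->|->] : [\/ m = 0, m = 1 | m = - 1].
- by case: m m1 => [[|[|n]]|[|n]] //= _; [apply: Or31 | apply: Or32 | apply: Or33].
- exact: calF_nat_small.
- exact: calF_nat_small.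
by rewrite calF_odd (calF_nat_pos _ _ 1) calF_nat_small //.
Qed.

Lemma calN_calF i j m :
  calN Ct i j m = (calF i j m - calF i j (m - 2)) - (calF i j (m + 2) - calF i j m).
Proof.
have := calF_step i j (m - 2); have := calF_step i j m.
rewrite subrK (_ : m - 2 + 1 = m - 1); last by lia.
by rewrite /calN => -> ->; ring.
Qed.

(* The column r, r + 2, ..., - xi_i ends just below the frozen vertex 2 - xi_i. *)
Lemma telescope_column (i : I) (r : int) (f : int -> int) :
  in_hatI xi (i, r) -> r <= 0 ->
  \sum_(0 <= k < `|r|.+1 | r + 2 * k%:Z <= 0)
    (f (r + 2 * k%:Z) - f (r + 2 * k%:Z + 2)) = f r - f (2 - xiZ xi i).
Proof.
(* The filter keeps exactly k = 0, ..., a, and r + 2(a + 1) = 2 - xi_i is the endpoint of the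
   telescope. *)
move=> hr r0; have [a ra] : exists a : nat, r = - xiZ xi i - 2 * a%:Z.
  case/dvdzP: hr => q /= rq; exists (absz (q + xiZ xi i)); move: rq r0; rewrite /xiZ.
  by case: (xi i) => /=; lia.
have xi01 : 0 <= xiZ xi i <= 1 by rewrite /xiZ; case: (xi i).
rewrite (big_cat_nat (n := a.+1)) //=; last by lia.
rewrite [X in _ + X]big1_seq ?addr0; last first.
  by move=> k /andP[kr]; rewrite mem_index_iota => ka; lia.
rewrite big_mkcond /=.
rewrite (@telescope_sumr_eq _ 0 _ (fun k => - f (r + 2 * k%:Z))) //.
  rewrite opprK mulr0 addr0 addrC; congr (f _ - f _); lia.
move=> k ka; case: ifP => [_|]; last by lia.
rewrite opprK [RHS]addrC.
by have -> : r + 2 * k%:Z + 2 = r + 2 * k.+1%:Z by lia.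
Qed.

Lemma calLE (v w : hatI_neg xi) :
  calL Ct v w = calF (val v).1 (val w).1 ((val w).2 - (val v).2)
    + calF (val v).1 (val w).1 (2 - xiZ xi (val v).1 - (val w).2)
    - calF (val v).1 (val w).1 (2 - xiZ xi (val w).1 - (val v).2).
Proof.
case: v w => [[i r] pv] [[j s] pw]; rewrite /calL /=.
have /andP[/= ir r0] := pv; have /andP[/= js s0] := pw.
(* The inner sum, telescoped in s, is itself a difference of step 2 of g, so the outer sum
   telescopes as well. *)
pose g t := calF i j (s - t) - calF i j (2 - xiZ xi j - t).
have gE t : g t - g (t + 2) = \sum_(0 <= l < `|s|.+1 | s + 2 * l%:Z <= 0)
    calN Ct i j (s + 2 * l%:Z - t).
  pose f y := calF i j (y - t) - calF i j (y - t - 2).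
  have -> : g t - g (t + 2) = f s - f (2 - xiZ xi j).
    by rewrite /g /f !opprD !addrA; ring.
  rewrite -(telescope_column f js s0); apply: eq_bigr => l _.
  rewrite calN_calF /f; congr (_ - (calF _ _ _ - calF _ _ _)); lia.
have -> : \sum_(0 <= k < `|r|.+1 | r + 2 * k%:Z <= 0)
    \sum_(0 <= l < `|s|.+1 | s + 2 * l%:Z <= 0)
      calN Ct i j (s + 2 * l%:Z - r - 2 * k%:Z) = g r - g (2 - xiZ xi i).
  rewrite -(telescope_column g ir r0); apply: eq_bigr => k _; rewrite gE.
  by apply: eq_bigr => l _; congr calN; lia.
(* The corner term has argument xi_i - xi_j, of absolute value at most 1. *)
have small : calF i j (2 - xiZ xi j - (2 - xiZ xi i)) = 0.
  by apply: calF_small; rewrite /xiZ; case: (xi i); case: (xi j).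
rewrite /g small (_ : s - (2 - xiZ xi i) = - (2 - xiZ xi i - s)); last by lia.
by rewrite calF_odd; ring.
Qed.

Lemma calL_skew (v w : hatI_neg xi) : calL Ct w v = - calL Ct v w.
Proof.
rewrite !calLE !(calF_sym (val w).1) -[_ - (val w).2 in LHS]opprB calF_odd.
by ring.
Qed.

Lemma uf_form_skew (p q : uf_gen xi) : uf_form Ct q p = - uf_form Ct p q.
Proof.
by case: p q => [v|i] [w|j] /=; rewrite ?opprK ?oppr0 // calL_skew.
Qed.

Lemma Lambda_skew (v w : hatI_le2 xi) : Lambda Ct w v = - Lambda Ct v w.
Proof. by rewrite /Lambda calF_sym -calF_odd opprB. Qed.

(** * Mutable and frozen vertices; the exponents of the tilde variables *)

Fact frozen_vertex_subproof (i : I) :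
  in_hatI xi (i, 2 - xiZ xi i) && (2 - xiZ xi i <= 2).
Proof. by rewrite /in_hatI /xiZ; case: (xi i). Qed.

Definition frozen_vertex (i : I) : hatI_le2 xi :=
  exist _ (i, 2 - xiZ xi i) (frozen_vertex_subproof i).

Fact widen_vertex_subproof (v : hatI_neg xi) :
  in_hatI xi (val v) && ((val v).2 <= 2).
Proof. by have /andP[-> /=] := valP v; lia. Qed.

Definition widen_vertex (v : hatI_neg xi) : hatI_le2 xi :=
  exist _ (val v) (widen_vertex_subproof v).

(** Parity leaves one row in 0 < r <= 2 for each i, namely r = 2 - xi_i. *)
Variant vertex_spec : hatI_le2 xi -> Prop :=
| VertexNeg v : vertex_spec (widen_vertex v)
| VertexFrozen i : vertex_spec (frozen_vertex i).

Lemma vertexP (v : hatI_le2 xi) : vertex_spec v.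
Proof.
have /andP[hv v2] := valP v; have [v0|v0] := lerP (val v).2 0.
  have pv : in_hatI xi (val v) && ((val v).2 <= 0) by rewrite hv.
  by rewrite (_ : v = widen_vertex (exist _ (val v) pv)); [left | apply: val_inj].
rewrite (_ : v = frozen_vertex (val v).1); first by right.
apply/val_inj; case: v hv v2 v0 => -[i r] /= _; rewrite /in_hatI /xiZ /=.
by move=> hr r2 r0; congr (_, _); case: (xi i) hr => /= /dvdzP[q]; lia.
Qed.

Lemma tilde_exponent_widen (v : hatI_neg xi) :
  tilde_exponent (widen_vertex v) =
  << (inl v : uf_gen xi) >> + << (inr (val v).1 : uf_gen xi) >>.
Proof. by rewrite /tilde_exponent /= valK. Qed.

Lemma tilde_exponent_frozen (i : I) :
  tilde_exponent (frozen_vertex i) = << (inr i : uf_gen xi) >>.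
Proof.
rewrite /tilde_exponent insubF //=.
by apply/negbTE; rewrite negb_and /xiZ; case: (xi i); rewrite orbT.
Qed.

Lemma tilde_L_Lambda : @tilde_L X Ct xi = @Lambda X Ct xi.
Proof.
apply/funext => v; apply/funext => w; rewrite /tilde_L /Lambda.
case: (vertexP v) => [{}v|i].
  rewrite tilde_exponent_widen; case: (vertexP w) => [{}w|j].
    (* The two [t_under] terms are opposite to the boundary terms of [calLE]. *)
    rewrite tilde_exponent_widen bilinU2U2 /= addr0 calLE /t_under.
    rewrite !(calF_sym (val w).1).
    rewrite -[2 - (val v).2 - _]addrAC -[2 - (val w).2 - _]addrAC; ring.
  rewrite tilde_exponent_frozen bilinU2U1 /= addr0 /t_under opprK calF_sym.
  by rewrite addrAC.
rewrite tilde_exponent_frozen; case: (vertexP w) => [{}w|j].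
  rewrite tilde_exponent_widen bilinU1U2 /= addr0 /t_under -calF_odd.
  by congr Defs.calF => /=; ring.
rewrite tilde_exponent_frozen bilinUU calF_small //= /xiZ.
by case: (xi i); case: (xi j).
Qed.

Definition tilde_exponent_inv (p : uf_gen xi) : {malg int[hatI_le2 xi]} :=
  match p with
  | inl v => << widen_vertex v >> - << frozen_vertex (val v).1 >>
  | inr i => << frozen_vertex i >>
  end.

Lemma tilde_exponentK v : linext tilde_exponent_inv (tilde_exponent v) = << v >>.
Proof.
case: (vertexP v) => [{}v|i].
  by rewrite tilde_exponent_widen linextU2 /= subrK.
by rewrite tilde_exponent_frozen linextU.
Qed.

Lemma tilde_exponent_invK p :
  linext (@tilde_exponent X xi) (tilde_exponent_inv p) = << p >>.
Proof.
case: p => [v|i] /=; last by rewrite linextU tilde_exponent_frozen.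
by rewrite linextBU2 tilde_exponent_widen tilde_exponent_frozen addrK.
Qed.

(** * Compatibility of the exchange matrix with Lambda *)

(** The default 0 lets neighbours be written as plain pairs, without a membership proof. *)
Definition vertex_monomial (p : I * int) : {malg int[hatI_le2 xi]} :=
  if insub p is Some v then << v >> else 0.

Lemma vertex_monomialE p v : (vertex_monomial p)@_v = (val v == p)%:R.
Proof.
rewrite /vertex_monomial; case: insubP => [u _ <-|].
  by rewrite mcoeffU val_eqE eq_sym.
by move=> hp; rewrite mcoeff0; case: eqP hp => // <-; rewrite (valP v).
Qed.

Lemma linext_vertex (f : I * int -> int) p :
  in_hatI xi p && (p.2 <= 2) -> linext (f \o val) (vertex_monomial p) = f p.
Proof.
by move=> hp; rewrite /vertex_monomial insubT linextU.
Qed.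

(** At a mutable vertex no arrow is discarded: C_ii = 2 gives the arrows of the column, and C_ij =
    -1 gives (j,r+1) -> (i,r) -> (j,r-1). *)
Lemma exch_Gamma_mutable (v : hatI_le2 xi) : v \in @mutable X xi ->
  let: (i, r) := val v in
  exch_Gamma v = vertex_monomial (i, r - 2) - vertex_monomial (i, r + 2)
    + \sum_(j | adj i j)
        (vertex_monomial (j, r + 1) - vertex_monomial (j, r - 1)).
Proof.
move=> vmu; case E : (val v) => [i r]; apply/malgP => w.
rewrite exch_GammaE mcoeffD mcoeffB !vertex_monomialE raddf_sum /=.
under eq_bigr => j _.
  rewrite mcoeffB !vertex_monomialE; over.
rewrite /Gamma_neg_arrow vmu /= !andbF !andbT /Gamma_arrow E.
case: (val w) => k s; rewrite !mxE !xpair_eqE /=.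
have [<-|ik] := eqVneq k i.
  rewrite big1 => [|j aij]; last first.
    have kj : k == j = false by apply: contraTF aij => /eqP <-; rewrite adj_irrefl.
    by rewrite !xpair_eqE kj subrr.
  by rewrite addr0; congr (_%:R - _%:R); apply/eqP/eqP; lia.
rewrite subrr add0r [adj k i]adj_sym; case: ifP => aik.
  rewrite (bigD1 k) //= big1 ?addr0 => [|j /andP[_ /negPf jk]].
    by rewrite !xpair_eqE eqxx; congr (_%:R - _%:R); apply/eqP/eqP; lia.
  by rewrite !xpair_eqE eq_sym jk subrr.
rewrite big1 ?subrr // => j aij.
have kj : k == j = false by apply: contraFF aik => /eqP ->.
by rewrite !xpair_eqE kj subrr.
Qed.

Lemma Gamma_compatible : compatible (@mutable X xi) (@exch_Gamma X xi) (@Lambda X Ct xi).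
Proof.
split; first exact: Lambda_skew.
(* The constant 2 is that of [bfC_rec]; the sign comes from [calF_step]. *)
exists (fun=> - 2); split; first by right.
move=> v w vmu; have := exch_Gamma_mutable vmu.
have := valP v; have : (val v).2 <= 0 by [].
case Ev : (val v) => [i r] /= r0 /andP[ir _] ->; case Ew : (val w) => [k s].
pose f (p : I * int) := calF p.1 k (s - p.2).
have bilinL a : bilin (@Lambda X Ct xi) a << w >> = linext (f \o val) a.
  rewrite bilinE; apply: eq_linext => u.
  by rewrite linextU /Lambda Ew.
rewrite bilinL linextD linextB linext_sum.
(* As r <= 0 and t <= 2, the neighbour is a genuine vertex and the default 0 is not met. *)
have vtx j (t : int) : (-2 <= t <= 2) -> (2 %| r + t - xiZ xi j)%Z ->
    linext (f \o val) (vertex_monomial (j, r + t)) = calF j k (s - (r + t)).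
  by move=> t2 hj; rewrite linext_vertex // /in_hatI hj /=; lia.
have ir' : (2 %| r - xiZ xi i)%Z by [].
(* Adjacent vertices have opposite parity, which places (j, r + 1) and (j, r - 1) in the vertex
   set. *)
have par j : adj i j -> xiZ xi i + xiZ xi j = 1.
  by move/hxi; rewrite /xiZ; case: (xi i); case: (xi j).
have -> : \sum_(j | adj i j) linext (f \o val)
      (vertex_monomial (j, r + 1) - vertex_monomial (j, r - 1)) =
    \sum_(j | adj i j) bfC j k (s - r).
  apply: eq_bigr => j aij; rewrite linextB.
  have e := par j aij; rewrite !vtx //; try lia.
  rewrite (_ : s - (r - 1) = s - (r + 1) + 2); last by lia.
  by rewrite calF_step (_ : s - (r + 1) + 1 = s - r); [ring | lia].
rewrite !vtx //; try lia.
(* The column neighbours give F(s-r+2) - F(s-r-2), a sum of two steps, hence the left side of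
   [bfC_rec] up to sign. *)
have e1 := calF_step i k (s - r); have e2 := calF_step i k (s - (r + 2)).
rewrite (_ : s - (r + 2) + 2 = s - r) in e2; last by lia.
rewrite (_ : s - (r + 2) + 1 = s - r - 1) in e2; last by lia.
rewrite (_ : s - r + 2 = s - (r - 2)) in e1; last by lia.
rewrite e1 e2; have e3 := bfC_rec (s - r) i k.
have -> : (v == w) = (s - r == 0) && (i == k).
  rewrite -val_eqE Ev Ew xpair_eqE andbC subr_eq0; congr (_ && _).
  exact: eq_sym.
rewrite (_ : (if _ then _ else _) = - (2 * ((s - r == 0) && (i == k))%:R)); last first.
  by case: ifP.
by rewrite -[2 * _](addrK (\sum_(j | adj i j) bfC j k (s - r))) -e3; ring.
Qed.

End CartanCombinatorics.

Theorem proposition7p2p3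
  (X : dynkin) (hX : is_dynkin X)
  (xi : 'I_(rank X) -> bool) (hxi : forall i j, adj i j -> xi i != xi j)
  (Ct : int -> 'M[int]_(rank X)) (hCt : qcartan_inverse Ct)
  (F1 : unitRingType) (h1 : F1) (z : hatI_le2 xi -> F1)
  (hF1 : qtorus_fraction_field (@Lambda X Ct xi) h1 z)
  (F2 : unitRingType) (h2 : F2) (uf : uf_gen xi -> F2)
  (hF2 : qtorus_fraction_field (@uf_form X Ct xi) h2 uf)
  (invf : bool) :
  [/\ is_quantum_seed h2 (@mutable X xi) (seed_tilde Ct h2 uf),
      is_quantum_seed h1 (@mutable X xi) (seed_Gamma Ct z)
    & qcluster_iso h2 (@mutable X xi) (seed_tilde Ct h2 uf)
                   h1 (@mutable X xi) (seed_Gamma Ct z) invf].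
Proof.
have LE := tilde_L_Lambda xi hCt.
have compat := Gamma_compatible hxi hCt.
(* The second field, rewritten in the tilde variables, becomes a field of fractions for the same
   form [Lambda] as the first. *)
have hF2' : qtorus_fraction_field (@Lambda X Ct xi) h2 (tilde_u Ct h2 uf).
  rewrite -LE; exact: (qtorus_fraction_field_change (uf_form_skew hCt)
    (@tilde_exponentK X xi) (@tilde_exponent_invK X xi) hF2).
have seedE : seed_tilde Ct h2 uf =
    Seed (tilde_u Ct h2 uf) (@exch_Gamma X xi) (@Lambda X Ct xi).
  by rewrite /seed_tilde LE.
rewrite seedE; split=> //.
have [Phi [Psi [PhiK PsiK Phih Phix]]] :=
  qtorus_fraction_field_iso (Lambda_skew hCt) hF2' hF1.
(* With equal exchange matrices and forms, matching the initial variables identifies the seeds. *)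
have mapE : map_seed Phi (Seed (tilde_u Ct h2 uf) (@exch_Gamma X xi)
    (@Lambda X Ct xi)) = seed_Gamma Ct z.
  by congr Seed; apply/funext.
rewrite -mapE -Phih; exact: qcluster_iso_map_seed PhiK PsiK.
Qed.
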